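(* For every integer $m\ge 1$ there exists a primitive TSR matrix of order $2$ over $\mathbb{F}_{2^m}$; that is, there exist $c_0,c_1\in\mathbb{F}_2$ and $A\in M_m(\mathbb{F}_2)$ such that the characteristic polynomial $\det(XI_{2m}-T)\in\mathbb{F}_2[X]$ of the $2m\times 2m$ matrix $$T=\begin{pmatrix}\mathbf{0} & c_0A\\ I_m & c_1A\end{pmatrix}$$ is a primitive polynomial of degree $2m$ over $\mathbb{F}_2$.
   Context: A polynomial of degree $d$ over a finite field $\mathbb{F}_Q$ is primitive if it is monic and irreducible and one (equivalently every) root generates the cyclic group $\mathbb{F}_{Q^d}^*$. Here $I_m$ and $\mathbf{0}$ denote the $m\times m$ identity and zero matrices over $\mathbb{F}_2$. *)

(* Defs.v *)
From HB Require Import structures.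
From mathcomp Require Import all_boot all_order all_algebra all_fingroup.
From mathcomp Require Import all_solvable all_field.

Set Implicit Arguments.
Unset Strict Implicit.
Unset Printing Implicit Defensive.

Import GRing.Theory.
Local Open Scope ring_scope.

Definition tsr2_mx (F : fieldType) (m : nat) (c0 c1 : F) (A : 'M[F]_m) :
    'M[F]_(m + m) :=
  block_mx 0 (c0 *: A) 1%:M (c1 *: A).

(* [primitive_poly] in [qfpoly] is phrased with the order of 'X modulo [p];
   this is the formulation with a root generating the unit group of the field
   with [#|F| ^ deg p] elements. *)
Lemma primitive_poly_rootP (F : finFieldType) (p : {poly F}) :
    (2 < size p)%N ->
  primitive_poly p <->
  [/\ p \is monic, irreducible_poly p &
      exists (L : finFieldType) (iota : {rmorphism F -> L}) (u : {unit L}),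
        [/\ #|L| = (#|F| ^ (size p).-1)%N,
            root (map_poly iota p) (val u) &
            generator [set: {unit L}] u]].
Proof.
move=> sp; split.
- move=> Hp; have [iP mP] := primitive_mi Hp; split=> //.
  pose L : finFieldType := {poly %/ p with primitive_mi Hp}.
  exists L, (in_alg L), (gX sp Hp); split.
  + exact: card_qfpoly.
  + have := in_qpoly_comp_horner p p 'X.
    rewrite comp_polyXr => e.
    have e0 : in_qpoly p p = 0.
      by apply/eqP; rewrite primitive_poly_in_qpoly_eq0 // dvdpp.
    rewrite e0 in e; apply/eqP; rewrite [RHS]e.
    congr (horner _ _); apply: eq_map_poly => a.
    apply: val_inj => /=.
    by rewrite -mul_polyC mulr1.
  + by rewrite /generator gX_all.
- case=> mP iP [L [iota [u [cL ru gu]]]].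
  have dvdE q : (p %| q) = root (map_poly iota q) (val u).
    apply/idP/idP => [/dvdpP[r ->]|rq].
      by rewrite rmorphM rootM ru orbT.
    apply: contraT; rewrite -irreducible_poly_coprime // => cpq.
    have : coprimep (map_poly iota p) (map_poly iota q) by rewrite coprimep_map.
    move/coprimep_root => /(_ _ ru); by rewrite (eqP rq) eqxx.
  have dvdX n : (p %| 'X^n - 1) = (#[u]%g %| n)%N.
    rewrite dvdE rmorphB /= map_polyXn rmorph1 /root !hornerE subr_eq0.
    rewrite order_dvdn -val_eqE /=.
    by rewrite FinRing.val_unitX.
  have ou : #[u]%g = #|L|.-1.
    rewrite orderE -(eqP gu) -(cardC1 (0 : L)) cardsT card_sub.
    by apply: eq_card => x; rewrite [LHS]unitfE.
  apply/primitive_polyP; rewrite card_monic_qpoly ?(ltn_trans _ sp) // -cL -ou.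
  split=> //; first by rewrite dvdX.
  by move=> n /andP[n0 nu]; rewrite dvdX gtnNdvd.
Qed.

(* Main.v *)
(* Write q = 2^m and L = F_(q^2). Let x be a generator of L^* with
   x + x^q = 1, put a = 1/x and b = a^(q+1), an element of F_q, so that
   a^2 = b (a - 1). If A is a companion matrix over F_2 having b as an
   eigenvalue, with row eigenvector v, then (v, a v) is an eigenvector of the
   TSR matrix with c_0 = -1 and c_1 = 1 for the eigenvalue a; hence its
   characteristic polynomial, of degree 2m, is the minimal polynomial of a.

   The generator x of trace 1 comes from a sieve over the primes dividing q^2 - 1.
   The line {x + x^q = 1} is a difference set of L^* relative to F_q^*, and
   the normalised indicator of the p-th powers has itself as autocorrelation, so
   the second moment of the sums of these weights over the translates of the
   line can be computed exactly; this yields the square-root bound usually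
   derived from Gauss sums, with rational arithmetic only. The sieve succeeds
   when 4^m - 1 has at most m/2 prime divisors, which holds for m > 6.

   For m <= 6, take u of order q + 1 such that t = u + 1/u has order q - 1, and
   x = u/t; such a u exists because the excluded u are roots of a polynomial of
   degree less than totient (q + 1). *)

Require Import Defs.
From HB Require Import structures.
From mathcomp Require Import all_boot all_order all_algebra all_fingroup.
From mathcomp Require Import all_solvable all_field.
From mathcomp Require Import ring lra zify.

Set Implicit Arguments.
Unset Strict Implicit.
Unset Printing Implicit Defensive.

Import GRing.Theory.
Local Open Scope ring_scope.
Import Order.TTheory Num.Theory.

(** * Power residue weights on the unit group *)

(** If the order [k] of [x] were a proper divisor of [n], then [k] would divide [n %/ p] for a prime
    [p] dividing [n %/ k]. *)
Lemma prim_root_of_primes (F : fieldType) (n : nat) (x : F) :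
    (0 < n)%N -> x ^+ n = 1 -> all (fun p => x ^+ (n %/ p) != 1) (primes n) ->
  n.-primitive_root x.
Proof.
move=> n0 xn /allP xP; have [k pk kn] := prim_order_exists n0 xn.
have [<-//|kNn] := eqVneq k n.
have d1 : (1 < n %/ k)%N.
  by rewrite ltn_divRL // mul1n ltn_neqAle kNn dvdn_leq.
have pd : (pdiv (n %/ k) %| n %/ k)%N := pdiv_dvd _.
have pn : (pdiv (n %/ k) %| n)%N.
  by apply: dvdn_trans pd _; rewrite -{2}(divnK kn) dvdn_mulr.
have := xP (pdiv (n %/ k)); rewrite mem_primes pdiv_prime // n0 pn => /(_ isT).
rewrite -(prim_order_dvd pk) -[X in (_ %| X %/ _)%N](divnK kn) -divn_mulAC //.
by rewrite dvdn_mull.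
Qed.

Section SieveWeights.

Variable L : finFieldType.
Implicit Types (x y g h c z : L) (p r : nat) (D E : seq nat).

Variable n : nat.
Hypothesis cardL : #|L| = n.+1.

Lemma unit_count_gt0 : (0 < n)%N.
Proof. by rewrite -ltnS -cardL finNzRing_gt1. Qed.
Local Hint Resolve unit_count_gt0 : core.

Lemma expf_card1 x : x != 0 -> x ^+ n = 1.
Proof.
move=> x0; apply: (mulIf x0).
by rewrite -exprSr mul1r -cardL expf_card.
Qed.

Lemma finField_prim_root : exists z : L, n.-primitive_root z.
Proof.
have /hasP[z _ pz] : has n.-primitive_root [seq x <- enum L | x != 0].
  apply: has_prim_root => //.
  - apply/allP => x; rewrite mem_filter unity_rootE => /andP[x0 _].
    by apply/eqP; exact: expf_card1.
  - by rewrite filter_uniq ?enum_uniq.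
  - have -> : n = #|predC1 (0 : L)| by rewrite cardC1 cardL.
    by rewrite cardE enumT; apply: eq_leq; congr size; apply: eq_filter.
by exists z.
Qed.

(* [is_power p x] says that [x] is a [p]-th power, for [x != 0] and [p] dividing
   [n]; [pweight p] is the indicator of the [p]-th powers minus its mean. *)
Definition is_power p x : bool := x ^+ (n %/ p) == 1.

Definition pweight p x : rat := (is_power p x)%:R - p%:R^-1.

Definition weight D x : rat := \prod_(p <- D) pweight p x.

Lemma weight_cons p D x : weight (p :: D) x = pweight p x * weight D x.
Proof. exact: big_cons. Qed.

Lemma is_power1 p : is_power p 1.
Proof. by rewrite /is_power expr1n. Qed.

Lemma is_powerMl p x y : is_power p x -> is_power p (x * y) = is_power p y.
Proof. by rewrite /is_power exprMn => /eqP->; rewrite mul1r. Qed.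

Lemma all_is_powerX D c i :
  all (is_power^~ c) D -> all (is_power^~ (c ^+ i)) D.
Proof.
move=> /allP cD; apply/allP => r /cD; rewrite /is_power => /eqP.
by rewrite exprAC => ->; rewrite expr1n.
Qed.

Lemma weightMl D c x : all (is_power^~ c) D -> weight D (c * x) = weight D x.
Proof.
elim: D => [|p D IH] /=; first by rewrite /weight !big_nil.
by case/andP=> cp cD; rewrite !weight_cons IH // /pweight is_powerMl.
Qed.

(** The powers of [c ^+ (n %/ p)] run once through the [p]-th roots of unity, so exactly one of them
    inverts [g ^+ (n %/ p)]. *)
Lemma sum_is_power p c g : prime p -> (p %| n)%N -> c != 0 -> g != 0 ->
  ~~ is_power p c -> \sum_(i < p) (is_power p (c ^+ i * g))%:R = 1 :> rat.
Proof.
move=> pp pn c0 g0; rewrite /is_power => cp.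
have xp x : x != 0 -> (x ^+ (n %/ p)) ^+ p = 1.
  by move=> x0; rewrite -exprM divnK // expf_card1.
have prc : p.-primitive_root (c ^+ (n %/ p)).
  have [k pk kp] := prim_order_exists (prime_gt0 pp) (xp c c0).
  have /primeP[_ /(_ k kp)/orP[]/eqP E] := pp; rewrite E in pk; last by [].
  by move: (prim_expr_order pk) cp; rewrite expr1 => ->; rewrite eqxx.
have [i0 Hi0] : {i : 'I_p | (g ^+ (n %/ p))^-1 = (c ^+ (n %/ p)) ^+ i}.
  by apply: (prim_rootP prc); rewrite exprVn xp ?invr1.
have gp0 : g ^+ (n %/ p) != 0 by rewrite expf_neq0.
have E i : ((c ^+ i * g) ^+ (n %/ p) == 1) = (i %% p == i0)%N.
  rewrite exprMn -(inj_eq (mulIf (invr_neq0 gp0))) mulfK // mul1r Hi0 [c ^+ i ^+ _]exprAC.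
  by rewrite (eq_prim_root_expr prc) (modn_small (ltn_ord i0)).
rewrite (bigD1 i0) //= E modn_small // eqxx big1 ?addr0 // => i ii0.
by rewrite E modn_small // val_eqE (negPf ii0).
Qed.

Lemma sum_pweight p c g : prime p -> (p %| n)%N -> c != 0 -> g != 0 ->
  ~~ is_power p c -> \sum_(i < p) pweight p (c ^+ i * g) = 0.
Proof.
move=> pp pn c0 g0 cp; rewrite big_split /= sum_is_power // sumr_const card_ord.
by rewrite -[X in 1 + X]mulr_natl mulrN divff ?subrr // pnatr_eq0 -lt0n prime_gt0.
Qed.

Lemma sum_pweight2 p c g h :
    prime p -> (p %| n)%N -> c != 0 -> g != 0 -> h != 0 -> ~~ is_power p c ->
  \sum_(i < p) pweight p (c ^+ i * g) * pweight p (c ^+ i * g * h) = pweight p h.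
Proof.
move=> pp pn c0 g0 h0 cp.
transitivity (\sum_(i < p) ((is_power p (c ^+ i * g))%:R * (is_power p h)%:R
   - p%:R^-1 * pweight p (c ^+ i * (g * h)) - p%:R^-1 * (is_power p (c ^+ i * g))%:R : rat)).
  apply: eq_bigr => i _; rewrite /pweight mulrA.
  case: (boolP (is_power p (c ^+ i * g))) => E; first by rewrite is_powerMl //=; ring.
  by rewrite /=; ring.
rewrite !sumrB -mulr_suml -!mulr_sumr sum_pweight ?mulf_neq0 // sum_is_power //.
by rewrite /pweight; ring.
Qed.

Lemma sum_orbit (X : pred L) c k (H : L -> rat) :
    c != 0 -> (forall x, X (c * x) = X x) ->
  \sum_(x | X x) \sum_(i < k) H (c ^+ i * x) = k%:R * \sum_(x | X x) H x.
Proof.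
move=> c0 Xc; rewrite exchange_big /=.
rewrite (eq_bigr (fun=> \sum_(x | X x) H x)) ?sumr_const ?card_ord ?mulr_natl //.
move=> i _; have inj : injective ( *%R (c ^+ i)) by apply/mulfI/expf_neq0.
rewrite [RHS](reindex_inj inj); apply: eq_bigl => x.
by elim: (nat_of_ord i) => [|j IH]; rewrite ?mul1r // exprS -mulrA Xc.
Qed.

(** With [z] a generator, [c] is [z] to the product of [D], which [p] does not divide. Translation
    by [c] moves the weight at [p] and leaves those at [D] unchanged. *)
Lemma separating_element p D :
    uniq (p :: D) -> all prime (p :: D) -> all (dvdn^~ n) (p :: D) ->
  exists c, [/\ c != 0, ~~ is_power p c & all (is_power^~ c) D].
Proof.
move=> /= /andP[pD _] /andP[pp primD] /andP[pn nD].
have [z pz] := finField_prim_root.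
exists (z ^+ \prod_(r <- D) r); split.
- by rewrite expf_neq0 // (prim_root_eq0 pz) -lt0n.
- rewrite /is_power -exprM -(prim_order_dvd pz).
  have k0 : (0 < n %/ p)%N by rewrite divn_gt0 ?prime_gt0 //; exact: dvdn_leq.
  rewrite -{1}(divnK pn) mulnC (dvdn_pmul2r k0).
  elim: D pD primD {nD} => [|r D IH]; rewrite ?big_nil ?big_cons ?dvdn1 /=.
    by move=> _ _; rewrite neq_ltn prime_gt1 ?orbT.
  rewrite inE negb_or => /andP[pr pD] /andP[rr primD].
  by rewrite Euclid_dvdM // negb_or IH // dvdn_prime2 // pr.
- apply/allP => r rD; rewrite /is_power -exprM -(prim_order_dvd pz).
  have rn := allP nD r rD.
  rewrite -{1}(divnK rn) mulnC dvdn_mul //.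
  by rewrite (big_rem r) //= dvdn_mulr.
Qed.

(* Up to the factor in front, convolution with [weight D] is an orthogonal
   projection (onto the span of the characters of order exactly [\prod_(p <- D) p]). *)
Lemma weight_autocorrelation D h :
    uniq D -> all prime D -> all (dvdn^~ n) D -> h != 0 ->
  \sum_(g | g != 0) weight D g * weight D (g * h) =
  (n%:R / (\prod_(p <- D) p)%:R) * weight D h.
Proof.
move=> + + + h0; elim: D => [|p D IH] uD prD nD.
  rewrite /weight !big_nil divr1 mulr1 (eq_bigr (fun=> 1)) => [|g _].
    by rewrite sumr_const (cardC1 (0 : L)) cardL.
  by rewrite !big_nil mulr1.
have [c [c0 cp cD]] := separating_element uD prD nD.
move: uD prD nD => /= /andP[_ uD] /andP[pp prD] /andP[pn nD].
have pN0 : p%:R != 0 :> rat by rewrite pnatr_eq0 -lt0n prime_gt0.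
apply: (mulfI pN0).
rewrite -(@sum_orbit (fun g => g != 0) c p) //; last first.
  by move=> x; rewrite mulf_eq0 negb_or c0.
have cDi i := all_is_powerX i cD.
transitivity (\sum_(g | g != 0) pweight p h * (weight D g * weight D (g * h))).
  apply: eq_bigr => g g0; rewrite -(sum_pweight2 pp pn c0 g0 h0 cp) mulr_suml.
  apply: eq_bigr => i _; rewrite !weight_cons -[c ^+ i * g * h]mulrA !(weightMl _ (cDi i)).
  by rewrite mulrA; ring.
rewrite -mulr_sumr IH // weight_cons big_cons natrM.
have ->: (\prod_(j <- D) j)%:R^-1 = p%:R * (p%:R * (\prod_(j <- D) j)%:R)^-1 :> rat.
  by rewrite invfM mulVKf.
by ring.
Qed.

(** Averaging over the powers of a separating [c] kills the factor at the first prime of [D]. *)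
Lemma sum_weight D : uniq D -> all prime D -> all (dvdn^~ n) D -> D != [::] ->
  \sum_(g | g != 0) weight D g = 0.
Proof.
case: D => // p D uD prD nD _.
have [c [c0 cp cD]] := separating_element uD prD nD.
move: uD prD nD => /= /andP[_ uD] /andP[pp prD] /andP[pn nD].
have pN0 : p%:R != 0 :> rat by rewrite pnatr_eq0 -lt0n prime_gt0.
apply: (mulfI pN0); rewrite mulr0.
rewrite -(@sum_orbit (fun g => g != 0) c p) //; last first.
  by move=> x; rewrite mulf_eq0 negb_or c0.
have cDi i := all_is_powerX i cD.
apply: big1 => g g0.
transitivity ((\sum_(i < p) pweight p (c ^+ i * g)) * weight D g).
  by rewrite mulr_suml; apply: eq_bigr => i _; rewrite weight_cons weightMl.
by rewrite sum_pweight ?mul0r.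
Qed.

End SieveWeights.

(** * The line of trace one *)

Lemma solve_trace_pair (F : fieldType) (h h' y y' : F) :
  y + y' = 1 -> h * y + h' * y' = 1 -> y * (h - h') = 1 - h'.
Proof. by move=> Ty <-; have -> : y' = 1 - y by [rewrite -Ty; ring]; ring. Qed.

Lemma card_expf_fixed_le (L : finFieldType) q : (1 < q)%N ->
  (#|[pred x : L | (x ^+ q == x)%R]| <= q)%N.
Proof.
move=> q1.
have sz : size ('X^q - 'X : {poly L}) = q.+1.
  by rewrite size_polyDl size_polyXn // size_polyN size_polyX.
rewrite -ltnS -sz cardE; apply: max_poly_roots; last exact: enum_uniq.
  by rewrite -size_poly_gt0 sz.
apply/allP => x; rewrite mem_enum unfold_in /root !hornerE => /eqP ->.
by rewrite subrr.
Qed.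

Section TraceLine.

Variables (L : finFieldType) (q : nat).
Hypothesis cardL : #|L| = (q * q)%N.
Hypothesis frobD : forall x y : L, (x + y) ^+ q = x ^+ q + y ^+ q.
Implicit Types (x y g h a : L).

Definition subfield x : bool := x ^+ q == x.
Definition trace_fiber a x : bool := x + x ^+ q == a.
Definition trace_line := trace_fiber 1.

Lemma frob_gt1 : (1 < q)%N.
Proof. by have := finNzRing_gt1 L; rewrite cardL; nia. Qed.
Let q_gt0 : (0 < q)%N := ltnW frob_gt1.

Lemma frobK x : (x ^+ q) ^+ q = x.
Proof. by rewrite -exprM -cardL expf_card. Qed.

Lemma frobB x y : (x - y) ^+ q = x ^+ q - y ^+ q.
Proof. by apply/eqP; rewrite eq_sym subr_eq -frobD subrK. Qed.

Lemma trace_fiber_le a : (#|trace_fiber a| <= q)%N.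
Proof.
have q1 := frob_gt1.
have sz : size ('X^q + ('X - a%:P) : {poly L}) = q.+1.
  by rewrite size_polyDl size_polyXn // size_XsubC.
rewrite -ltnS -sz cardE; apply: max_poly_roots; last exact: enum_uniq.
  by rewrite -size_poly_gt0 sz.
apply/allP => x; rewrite mem_enum unfold_in /root !(hornerD, hornerN, hornerXn, hornerX, hornerC)
  => /eqP <-.
by rewrite addrA [x ^+ q + x]addrC subrr.
Qed.

(** The trace maps the [q * q] elements of [L] into a subfield of at most [q] elements with fibres
    of at most [q] elements, so no fibre over the subfield can be smaller. *)
Lemma card_trace_line : #|trace_line| = q.
Proof.
apply/eqP; rewrite eqn_leq trace_fiber_le /=.
have H : (#|L| = \sum_(a | subfield a) #|trace_fiber a|)%N.
  rewrite -sum1_card (partition_big (fun x => x + x ^+ q) subfield) /=.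
    by apply: eq_bigr => a _; rewrite sum1_card.
  by move=> x _; rewrite /subfield frobD frobK addrC.
have K1 : subfield 1 by rewrite /subfield expr1n.
rewrite (bigD1 1) //= cardL in H.
have H2 : (\sum_(a | subfield a && (a != 1%R)) #|trace_fiber a|
   <= q.-1 * q)%N.
  apply: leq_trans (_ : \sum_(a | subfield a && (a != 1%R)) q <= _)%N.
    by apply: leq_sum => a _; exact: trace_fiber_le.
  rewrite sum_nat_const leq_mul2r; apply/orP; right.
  have := card_expf_fixed_le L frob_gt1; rewrite (cardD1 1) inE [1 ^+ q == 1]K1 add1n.
  rewrite -[X in (_ < X)%N -> _](prednK q_gt0) ltnS; apply: leq_trans.
  by apply: eq_leq; apply: eq_card => a; rewrite !inE /= andbC.
rewrite -(leq_add2r (q.-1 * q)) -mulSn prednK // [X in (X <= _)%N]H leq_add2l.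
exact: H2.
Qed.

Lemma trace_line_neq0 x : trace_line x -> x != 0.
Proof.
apply: contraTneq => ->; rewrite /trace_line /trace_fiber expr0n gtn_eqF //.
by rewrite addr0 eq_sym oner_eq0.
Qed.

(* [trace_line] is a difference set of the unit group relative to the subgroup
   of nonzero elements of the subfield. *)
Lemma sum_trace_line_quotient (f : L -> rat) :
  \sum_(x | trace_line x) \sum_(y | trace_line y) f (x / y) =
  q%:R * f 1 + \sum_(h | ~~ subfield h) f h.
Proof.
rewrite exchange_big /=.
transitivity (\sum_(y | trace_line y) \sum_(h | trace_line (h * y)) f h).
  apply: eq_bigr => y /trace_line_neq0 y0.
  rewrite (reindex_inj (mulIf y0)) /=; apply: eq_bigr => h _.
  by rewrite mulfK.
(* For [h] in the subfield, [h * y] has trace [h], so only [h = 1] occurs; every other [h]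
   determines [y] by a linear equation. *)
rewrite (exchange_big_dep predT) //= (bigID subfield) /=; congr (_ + _).
  rewrite (bigD1 1) ?/subfield ?expr1n //= [X in _ + X]big1 ?addr0.
    rewrite (eq_bigl trace_line) => [|y]; last by rewrite mul1r andbb.
    by rewrite sumr_const card_trace_line mulr_natl.
  move=> h /andP[/eqP Kh h1]; apply: big_pred0 => y.
  apply/negP => /andP[/eqP Ty]; rewrite /trace_line /trace_fiber exprMn Kh -mulrDr Ty mulr1.
  by rewrite (negPf h1).
apply: eq_bigr => h Kh.
have d0 : h - h ^+ q != 0 by rewrite subr_eq0 eq_sym.
apply: (big_pred1 ((1 - h ^+ q) / (h - h ^+ q))) => y /=.
apply/andP/eqP => [[/eqP Ty /eqP Thy]|->].
  apply: (mulIf d0); rewrite divfK //.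
  by apply: (solve_trace_pair Ty); rewrite -exprMn.
have d0' : h ^+ q - h != 0 by rewrite -oppr_eq0 opprB.
rewrite /trace_line /trace_fiber !exprMn exprVn !frobB frobK expr1n.
by split; apply/eqP; field; rewrite d0 d0'.
Qed.

(* The left-hand side is, up to a positive factor, a sum of squares over the
   cosets of the subfield. *)
Lemma sum_subfield_ge0 (f : L -> rat) (k : rat) : 0 < k ->
    (forall h, h != 0 -> \sum_(g | g != 0) f g * f (g * h) = k * f h) ->
  0 <= \sum_(h | subfield h && (h != 0)) f h.
Proof.
move=> k0 Hf; rewrite -(pmulr_rge0 _ k0) mulr_sumr.
under eq_bigr => h /andP[_ h0] do rewrite -Hf //.
set S := \sum_(h | _) _.
suff ->: S = (#|[pred h | subfield h && (h != 0)]|%:R)^-1 *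
    \sum_(g | g != 0) (\sum_(h | subfield h && (h != 0)) f (g * h)) ^+ 2.
  by rewrite mulr_ge0 ?invr_ge0 ?ler0n // sumr_ge0 // => g _; exact: sqr_ge0.
have K0 : #|[pred h | subfield h && (h != 0)]|%:R != 0 :> rat.
  rewrite pnatr_eq0 -lt0n; apply/card_gt0P; exists 1.
  by rewrite inE /subfield expr1n oner_neq0 eqxx.
apply: (mulfI K0); rewrite mulVKf //.
rewrite mulr_natl -sumr_const.
transitivity (\sum_(c | subfield c && (c != 0)) \sum_(h | subfield h && (h != 0))
    \sum_(g | g != 0) f (g * c) * f (g * h)).
  apply: eq_bigr => c; rewrite inE => /andP[/eqP Kc c0].
  rewrite /S [RHS](reindex_inj (mulIf c0)) /=.
  apply: eq_big => [h|h _].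
    by rewrite /subfield exprMn Kc (inj_eq (mulIf c0)) mulf_eq0 negb_or c0 andbT.
  rewrite (reindex_inj (mulIf c0)) /=.
  apply: eq_big => [g|g _]; first by rewrite mulf_eq0 negb_or c0 andbT.
  by congr (_ * f _); ring.
under [RHS]eq_bigr => g _ do rewrite expr2 mulr_suml.
rewrite [RHS]exchange_big /=; apply: eq_bigr => c _.
under [RHS]eq_bigr => g _ do rewrite mulr_sumr.
by rewrite [RHS]exchange_big.
Qed.

(** Let [F g] be the sum of [f] over the line translated by [g]. The sums of [F g * f g] and
    [f g ^+ 2] are known exactly and that of [F g ^+ 2] is at most [k * (q%:R * f 1)], so
    Cauchy-Schwarz bounds [F 1]. *)
Lemma trace_line_sum_bound (f : L -> rat) (k : rat) : 0 < k -> 0 < f 1 ->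
    (forall h, h != 0 -> \sum_(g | g != 0) f g * f (g * h) = k * f h) ->
    \sum_(g | g != 0) f g = 0 ->
  (\sum_(x | trace_line x) f x) ^+ 2 <= q%:R * f 1 ^+ 2.
Proof.
move=> k0 f10 Hf f0.
pose F g := \sum_(x | trace_line x) f (g * x).
have F1 : F 1 = \sum_(x | trace_line x) f x by apply: eq_bigr => x _; rewrite mul1r.
have Ff : \sum_(g | g != 0) F g * f g = k * F 1.
  rewrite F1 mulr_sumr; under eq_bigr => g _ do rewrite mulr_suml.
  rewrite exchange_big /=; apply: eq_bigr => x /trace_line_neq0 x0.
  by rewrite -Hf //; apply: eq_bigr => g _; rewrite mulrC.
have ff : \sum_(g | g != 0) f g ^+ 2 = k * f 1.
  by rewrite -Hf ?oner_neq0 //; apply: eq_bigr => g _; rewrite mulr1 expr2.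
have FF : \sum_(g | g != 0) F g ^+ 2 <= k * (q%:R * f 1).
  have ->: \sum_(g | g != 0) F g ^+ 2 =
      \sum_(x | trace_line x) \sum_(y | trace_line y) k * f (x / y).
    under eq_bigr => g _ do rewrite expr2 mulr_sumr.
    rewrite exchange_big /=; apply: eq_bigr => x Tx.
    under eq_bigr => g _ do rewrite mulr_suml.
    rewrite exchange_big /=; apply: eq_bigr => y Ty.
    have [x0 y0] := (trace_line_neq0 Tx, trace_line_neq0 Ty).
    rewrite -Hf ?mulf_neq0 ?invr_eq0 // [RHS](reindex_inj (mulIf y0)) /=.
    apply: eq_big => [g|g _]; first by rewrite mulf_eq0 negb_or y0 andbT.
    by congr (f _ * f _); field.
  rewrite (sum_trace_line_quotient (fun h => k * f h)) -mulr_sumr.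
  rewrite mulrCA -mulrDr ler_pM2l // gerDl.
  (* As [f] sums to zero, its sum off the subfield is minus the nonnegative sum over the nonzero
     subfield elements. *)
  have := sum_subfield_ge0 k0 Hf.
  move: f0; rewrite (bigID subfield) /= => /eqP; rewrite addr_eq0 => /eqP f0.
  rewrite (eq_bigl (fun h => (h != 0) && subfield h)) => [|h]; last by rewrite andbC.
  rewrite f0 oppr_ge0; congr (_ <= _); apply: eq_bigl => h.
  apply/andP/idP => [[]//|Kh]; split=> //; apply: contraNneq Kh => ->.
  by rewrite /subfield expr0n gtn_eqF.
(* Cauchy-Schwarz for [F] and [f]. *)
have : 0 <= \sum_(g | g != 0) (F g - F 1 / f 1 * f g) ^+ 2.
  by apply: sumr_ge0 => g _; exact: sqr_ge0.
have ->: \sum_(g | g != 0) (F g - F 1 / f 1 * f g) ^+ 2 =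
  \sum_(g | g != 0) F g ^+ 2 - 2 * (F 1 / f 1) * (\sum_(g | g != 0) F g * f g) +
  (F 1 / f 1) ^+ 2 * \sum_(g | g != 0) f g ^+ 2.
  by rewrite !mulr_sumr -sumrB -big_split /=; apply: eq_bigr => g _; ring.
rewrite Ff ff => H.
have {}H : k * (F 1 ^+ 2 / f 1) <= k * (q%:R * f 1).
  apply: le_trans FF; rewrite -subr_ge0; move: H; congr (_ <= _).
  by field; rewrite gt_eqF.
move: H; rewrite ler_pM2l // ler_pdivrMr // F1 => H.
by rewrite expr2 mulrA.
Qed.

End TraceLine.

(** * The sieve *)

Section Sieve.

Variables (L : finFieldType) (n q : nat).
Hypothesis cardLn : #|L| = n.+1.
Hypothesis cardLq : #|L| = (q * q)%N.
Hypothesis frobD : forall x y : L, (x + y) ^+ q = x ^+ q + y ^+ q.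
Implicit Types (x : L) (D E : seq nat) (p s : nat).

(** For distinct primes dividing [n], this is the proportion of units that are a [p]-th power for no
    [p] in [D]. *)
Definition density D : rat := \prod_(p <- D) (1 - p%:R^-1).

Lemma density_cons p D : density (p :: D) = (1 - p%:R^-1) * density D.
Proof. exact: big_cons. Qed.

Lemma density_gt0 D : all prime D -> 0 < density D.
Proof.
move=> /allP prD; rewrite /density big_seq; apply: prodr_gt0 => p /prD pp.
by rewrite subr_gt0 invf_lt1 ?ltr0n ?ltr1n ?prime_gt0 ?prime_gt1.
Qed.

Lemma weight1 D : weight n D (1 : L) = density D.
Proof. by apply: eq_bigr => p _; rewrite /pweight is_power1. Qed.

(** The integer [s] stands in for the square root of [q], so that the bound remains rational. *)
Lemma weight_trace_line_le s D : (q <= s ^ 2)%N ->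
    uniq D -> all prime D -> all (dvdn^~ n) D -> D != [::] ->
  `|\sum_(x : L | trace_line q x) weight n D x| <= s%:R * density D.
Proof.
move=> qs uD prD nD D0.
have dD := density_gt0 prD.
rewrite -(@ler_pXn2r _ 2) // ?nnegrE ?mulr_ge0 ?ler0n ?(ltW dD) //.
rewrite -normrX ger0_norm ?sqr_ge0 // exprMn -(weight1 D).
apply: le_trans (_ : q%:R * weight n D (1 : L) ^+ 2 <= _); last first.
  by rewrite ler_wpM2r ?sqr_ge0 // -natrX ler_nat.
apply: (@trace_line_sum_bound L q cardLq frobD (weight n D)
  (n%:R / (\prod_(p <- D) p)%:R)).
- rewrite divr_gt0 ?ltr0n ?(unit_count_gt0 cardLn) // big_seq.
  by apply: prodn_cond_gt0 => p pD; rewrite prime_gt0 ?(allP prD).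
- by rewrite weight1.
- by move=> h; exact: (weight_autocorrelation cardLn).
- exact: (sum_weight cardLn).
Qed.

(* Moving one prime from [E] to [D] splits the factor [~~ is_power n p x] into its
   mean [1 - p^-1] and the weight [- pweight n p x]. *)
Lemma sieve_error s D E : (q <= s ^ 2)%N ->
    uniq (D ++ E) -> all prime (D ++ E) -> all (dvdn^~ n) (D ++ E) ->
  `|\sum_(x : L | trace_line q x)
      weight n D x * \prod_(p <- E) (~~ is_power n p x)%:R
    - (D == [::])%:R * q%:R * density E|
  <= s%:R * (density D * density E) * (2 ^+ size E - (D == [::])%:R).
Proof.
move=> qs; elim: E D => [|p E IH] D; rewrite ?cats0 => uD prD nD.
  under eq_bigr do rewrite big_nil mulr1.
  rewrite /density big_nil expr0 !mulr1.
  (* With both lists empty the sum counts the line exactly, which is why the bound subtracts [(D ==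
     [::])%:R]. *)
  have [->|D0] := eqVneq D [::]; last first.
    by rewrite mul0r !subr0 mulr1 weight_trace_line_le.
  under eq_bigr do rewrite /weight big_nil.
  by rewrite sumr_const (card_trace_line cardLq frobD) mul1r !subrr normr0 mulr0.
have perm : perm_eq (D ++ p :: E) ((p :: D) ++ E) by rewrite perm_catC /= perm_cons perm_catC.
have perm' : perm_eq (D ++ p :: E) (p :: (D ++ E)) by [].
have := IH (p :: D); rewrite -(perm_uniq perm) -!(perm_all _ perm) => /(_ uD prD nD).
rewrite /= mul0r mul0r !subr0 density_cons.
move: uD prD nD; rewrite (perm_uniq perm') !(perm_all _ perm').
move=> /andP[_ uD] /andP[pp prD] /andP[_ nD].
have := IH D uD prD nD.
set M := (D == [::])%:R; rewrite density_cons exprS.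
set A := \sum_(x | _) _; set B := \sum_(x | _) _; set C := \sum_(x | _) _.
set t := 1 - p%:R^-1.
have -> : C = t * A - B.
  rewrite /A /B /C mulr_sumr -sumrB; apply: eq_bigr => x _.
  rewrite big_cons weight_cons /pweight /t.
  by case: (is_power n p x) => /=; ring.
have t0 : 0 <= t by rewrite subr_ge0 invf_le1 ?ltr0n ?ler1n ?prime_gt0.
move=> HA HB.
have -> : t * A - B - M * q%:R * (t * density E) = t * (A - M * q%:R * density E) - B.
  by ring.
apply: le_trans (ler_normB _ _) _; rewrite normrM (ger0_norm t0).
apply: le_trans (lerD (ler_wpM2l t0 HA) HB) _.
by rewrite le_eqVlt; apply/orP; left; apply/eqP; ring.
Qed.

(** The sieve counts the elements of the line that are a [p]-th power for no prime [p] dividing [n],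
    that is, the generators. Up to the common density, the main term is [q] and the error at most
    [s * (2 ^ size (primes n) - 1)]. *)
Lemma sieve_prim_root s : (0 < s)%N -> (q <= s ^ 2)%N ->
    (2 ^ size (primes n) * s <= q)%N ->
  exists2 x : L, n.-primitive_root x & x + x ^+ q = 1.
Proof.
move=> s0 qs big_q.
have prE : all prime (primes n) by apply/allP => p; rewrite mem_primes => /andP[].
have nE : all (dvdn^~ n) (primes n) by apply/allP => p; rewrite mem_primes => /and3P[].
have := @sieve_error s [::] (primes n) qs (primes_uniq n) prE nE.
rewrite eqxx mul1r; under eq_bigr do rewrite /weight big_nil mul1r.
rewrite [density [::]]/density big_nil mul1r ler_norml => /andP[+ _].
have dE := density_gt0 prE; set S := \sum_(x | _) _ => HS.
have S0 : 0 < S.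
  have := ler_nat rat (2 ^ size (primes n) * s) q; rewrite big_q natrM natrX => bq.
  have s1 : 0 < s%:R * density (primes n) by rewrite mulr_gt0 ?ltr0n.
  move: HS; rewrite lerBrDl; apply: lt_le_trans.
  have := ler_wpM2r (ltW dE) bq.
  rewrite mulrBr mulr1. nra.
have [x /andP[Tx xP]] : exists x, trace_line q x && all (fun p => ~~ is_power n p x) (primes n).
  apply/existsP; apply: contraTT S0 => /existsPn nx.
  rewrite -leNgt /S big1 // => x Tx; have := nx x; rewrite Tx /= => /allPn[p pE /negPn px].
  by rewrite (big_rem p) //= px mul0r.
exists x; last by apply/eqP.
apply: prim_root_of_primes (unit_count_gt0 cardLn) _ xP.
apply: (expf_card1 cardLn); exact: (trace_line_neq0 cardLq Tx).
Qed.

End Sieve.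

(** * Prime divisors of 4 ^ m - 1 *)

Section PrimeDivisors.

Local Open Scope nat_scope.

Lemma prod_primes_le N : 0 < N -> \prod_(p <- primes N) p <= N.
Proof.
move=> N0; rewrite {2}(prod_prime_decomp N0) prime_decompE big_map /=.
rewrite big_seq [X in _ <= X]big_seq; apply: leq_prod => p.
rewrite -logn_gt0 => lp; rewrite -{1}[p]expn1.
have : prime p by move: lp; rewrite lognE; case: (prime p).
by move=> pp; rewrite leq_exp2l // prime_gt1.
Qed.

Lemma prod_le_expn c (S : seq nat) :
  all (fun p => p <= c) S -> \prod_(p <- S) p <= c ^ size S.
Proof.
elim: S => [|p S IH] /=; rewrite ?big_nil ?big_cons // => /andP[pc /IH le].
by rewrite expnS leq_mul.
Qed.

Lemma expn_le_prod c (S : seq nat) :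
  all (fun p => c <= p) S -> c ^ size S <= \prod_(p <- S) p.
Proof.
elim: S => [|p S IH] /=; rewrite ?big_nil ?big_cons // => /andP[pc /IH le].
by rewrite expnS leq_mul.
Qed.

(** Prime factors outside [S] are at least [2 ^ b], and the product of all prime factors is at most
    [N]. Elements of [S] that are not prime factors only weaken the bound, being at most [2 ^ b]. *)
Lemma size_primes_le N b (S : seq nat) : 0 < N -> uniq S ->
    all (fun p => 0 < p <= 2 ^ b) S ->
    (forall p, prime p -> p %| N -> p < 2 ^ b -> p \in S) ->
  2 ^ (b * size (primes N)) * \prod_(p <- S) p <= 2 ^ (b * size S) * N.
Proof.
move=> N0 uS /allP bS HS.
pose P := [seq p <- primes N | p \in S]; pose P' := [seq p <- primes N | p \notin S].
have sz : size (primes N) = size P + size P' by rewrite !size_filter count_predC.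
have pr : \prod_(p <- primes N) p = \prod_(p <- P) p * \prod_(p <- P') p.
  by rewrite (bigID (mem S)) /= !big_filter.
pose S' := [seq p <- S | p \notin primes N].
have PS : perm_eq P [seq p <- S | p \in primes N].
  apply: uniq_perm; rewrite ?filter_uniq ?primes_uniq // => p.
  by rewrite !mem_filter andbC.
have szS : size S = size P + size S'.
  by rewrite (perm_size PS) !size_filter count_predC.
have prS : \prod_(p <- S) p = \prod_(p <- P) p * \prod_(p <- S') p.
  by rewrite (perm_big _ PS) (bigID (mem (primes N))) /= !big_filter.
have leS' : \prod_(p <- S') p <= 2 ^ (b * size S').
  rewrite expnM; apply: prod_le_expn; apply/allP => p.
  by rewrite mem_filter => /andP[_ /bS/andP[]].
have leP' : 2 ^ (b * size P') <= \prod_(p <- P') p.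
  rewrite expnM; apply: expn_le_prod; apply/allP => p.
  rewrite mem_filter mem_primes => /andP[pS /and3P[pp _ pN]].
  by rewrite leqNgt; apply: contra pS; exact: HS.
have le := prod_primes_le N0.
rewrite sz szS prS !mulnDr !expnD pr in le *.
set x := 2 ^ _; set y := \prod_(p <- P) p in le *.
apply: leq_trans (_ : x * (y * \prod_(p <- P') p) * 2 ^ (b * size S') <= _).
  by rewrite mulnACA [x * (_ * _)]mulnA -[X in _ <= X]mulnA leq_mul // leq_mul.
by rewrite [X in _ <= X]mulnAC leq_mul2r leq_mul2l le !orbT.
Qed.


Lemma expn4_modn m p : 4 ^ m %% p = iter m (fun x => (4 * x) %% p) (1 %% p).
Proof. by elim: m => // m IH; rewrite expnS iterS -IH modnMmr. Qed.

Lemma dvdn_expn4_sub1 m p : 1 < p ->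
  (p %| 4 ^ m - 1) = (iter m (fun x => (4 * x) %% p) (1 %% p) == 1).
Proof.
by move=> p1; rewrite -expn4_modn -eqn_mod_dvd ?expn_gt0 // [1 %% p]modn_small // eq_sym.
Qed.

Lemma size_primes_expn4_sub1 m l (S : seq nat) : 0 < m -> uniq S ->
    all (fun p => 0 < p <= 32) S ->
    (forall p, prime p -> p < 32 -> p %| 4 ^ m - 1 -> p \in S) ->
    2 ^ l <= \prod_(p <- S) p ->
  5 * size (primes (4 ^ m - 1)) + l < 5 * size S + 2 * m.
Proof.
move=> m0 uS bS HS lS.
have N0 : 0 < 4 ^ m - 1 by rewrite subn_gt0 -{1}(expn0 4) ltn_exp2l.
have := @size_primes_le (4 ^ m - 1) 5 S N0 uS bS.
move=> /(_ (fun p pp pN p32 => HS p pp p32 pN)) le.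
rewrite -(@ltn_exp2l 2) // [2 ^ (_ + l)]expnD [2 ^ (5 * size S + _)]expnD.
rewrite [2 ^ (2 * m)]expnM.
apply: leq_ltn_trans (_ : _ <= 2 ^ (5 * size (primes (4 ^ m - 1))) * \prod_(p <- S) p) _.
  by rewrite leq_mul2l lS orbT.
apply: leq_ltn_trans le _; rewrite ltn_pmul2l ?expn_gt0 //.
by rewrite ltn_subrL expn_gt0.
Qed.

Lemma prime_lt32 p : prime p -> p < 32 ->
  p \in [:: 2; 3; 5; 7; 11; 13; 17; 19; 23; 29; 31].
Proof. by move=> pp p32; move: p p32 pp; do 32!case=> //. Qed.

Definition small_primes : seq nat := [:: 3; 5; 7; 11; 13; 17; 19; 23; 29; 31].

Definition small_divisors m : seq nat :=
  [seq p <- small_primes | iter m (fun x => (4 * x) %% p) (1 %% p) == 1].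

Lemma small_divisorsP m p : 0 < m -> prime p -> p < 32 -> p %| 4 ^ m - 1 ->
  p \in small_divisors m.
Proof.
move=> m0 pp p32; rewrite dvdn_expn4_sub1 ?prime_gt1 // mem_filter => pm.
rewrite pm; have := prime_lt32 pp p32; rewrite inE => /orP[/eqP p2|//].
by move: pm; rewrite p2; case: (m) m0 => // k _; rewrite iterS -modnMml.
Qed.

(* The primes below 32 weigh enough in the product to settle all large [m]; for
   the remaining [m], only those that really divide [4 ^ m - 1] are counted. *)
Lemma size_primes_le_half m : 6 < m -> size (primes (4 ^ m - 1)) <= m./2.
Proof.
move=> m6; have m0 : 0 < m by apply: leq_trans m6.
(* These are the [m > 6] for which the bound from all of [small_primes], whose product exceeds
   [2 ^ 36], does not reach [m./2]. *)
pose ms := iota 7 11 ++ [:: 19; 21].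
have [mS|mS] := boolP (m \in ms); last first.
  have : 5 * size (primes (4 ^ m - 1)) + 36 < 5 * 10 + 2 * m.
    apply: (@size_primes_expn4_sub1 m 36 small_primes); rewrite // ?unlock /=; last lia.
    by move=> p pp p32 pN; have := small_divisorsP m0 pp p32 pN; rewrite mem_filter => /andP[].
  by move: mS; rewrite mem_cat mem_iota !inE; move: (size _) => k; lia.
pose l k := trunc_log 2 (foldr muln 1 (small_divisors k)).
(* Together with the strict bound that follows, this gives [5 * size (primes (4 ^ m - 1)) < 5 *
   (m./2 + 1)]. *)
have /allP/(_ m mS) : all (fun k =>
    5 * size (small_divisors k) + 2 * k <= 5 * k./2 + 5 + l k) ms.
  by vm_compute.
have : 5 * size (primes (4 ^ m - 1)) + l m < 5 * size (small_divisors m) + 2 * m.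
  apply: size_primes_expn4_sub1 => //.
  - exact: filter_uniq.
  - by apply/allP => p; rewrite mem_filter => /andP[_]; apply/allP: p.
  - by move=> p; exact: small_divisorsP.
  rewrite /l foldrE; apply: trunc_logP => //.
  rewrite big_seq prodn_cond_gt0 // => p.
  by rewrite mem_filter => /andP[_]; apply/allP: p.
move: (size (primes _)) (size (small_divisors m)) (l m) => k j i; lia.
Qed.

End PrimeDivisors.

(** * Fields with at most 2 ^ 12 elements *)

Section SmallFields.

Variables (L : finFieldType) (m : nat).
Hypothesis char2 : 2%N \in [pchar L].
Local Notation q := (2 ^ m)%N.
Hypothesis cardL : #|L| = (q * q)%N.
Implicit Types (x t u : L) (d e j k s : nat).

Lemma frobenius2D j x y : (x + y) ^+ (2 ^ j) = x ^+ (2 ^ j) + y ^+ (2 ^ j).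
Proof. by rewrite exprDn_pchar // pnatX pnatE // char2. Qed.

(* [u] and [u^-1] are the roots of ['X^2 - (u + u^-1) *: 'X + 1], hence are
   permuted by any power of the Frobenius map that fixes [u + u^-1]. *)
Lemma exprV_trace_fixed j u : u != 0 -> (u + u^-1) ^+ (2 ^ j) = u + u^-1 ->
  u ^+ (2 ^ j).-1 = 1 \/ u ^+ (2 ^ j).+1 = 1.
Proof.
move=> u0; rewrite frobenius2D exprVn => E.
have v0 : u ^+ (2 ^ j) != 0 by rewrite expf_neq0.
have : (u ^+ (2 ^ j) - u) * (1 - (u ^+ (2 ^ j) * u)^-1) = 0.
  have -> : (u ^+ (2 ^ j) - u) * (1 - (u ^+ (2 ^ j) * u)^-1) =
      (u ^+ (2 ^ j) + u ^- (2 ^ j)) - (u + u^-1) by field; rewrite u0.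
  by rewrite E subrr.
move/eqP; rewrite mulf_eq0 !subr_eq0 => /orP[]/eqP H.
  left; apply: (mulIf u0); rewrite -exprSr prednK ?expn_gt0 //.
  by rewrite H mul1r.
by right; rewrite exprSr -[LHS]invrK -H invr1.
Qed.

(** [L] has [totient q.+1] elements of order [q + 1], more than [Q] can have roots. *)
Lemma exists_order_qS (Q : {poly L}) : (0 < m)%N -> Q != 0 ->
    (size Q <= totient q.+1)%N ->
  exists2 u, (q.+1).-primitive_root u & ~~ root Q u.
Proof.
move=> m0 Q0 sQ.
have q1 : (1 < q)%N by rewrite -{1}(expn0 2) ltn_exp2l.
have cL : #|L| = (q.-1 * q.+1).+1 by rewrite cardL; nia.
have [z pz] := finField_prim_root cL.
have := dvdn_prim_root pz (dvdn_mull q.-1 (dvdnn q.+1)); rewrite mulnK //.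
set w := z ^+ _ => pw.
pose rs := [seq w ^+ i | i <- iota 0 q.+1 & coprime q.+1 i].
have urs : uniq rs.
  rewrite map_inj_in_uniq ?filter_uniq ?iota_uniq // => i k.
  rewrite !mem_filter !mem_iota !add0n => /andP[_ iq] /andP[_ kq] /eqP.
  by rewrite (eq_prim_root_expr pw) !modn_small // => /eqP.
have srs : size rs = totient q.+1.
  rewrite size_map size_filter -sum1_count totient_count_coprime.
  rewrite /index_iota subn0 big_mkcond; apply: eq_bigr => i _.
  by case: coprime.
have : ~~ all (root Q) rs.
  by apply/negP => /(max_poly_roots Q0) /(_ urs); rewrite srs ltnNge sQ.
case/allPn => _ /mapP[i iP ->] nr; exists (w ^+ i) => //.
by rewrite (prim_root_exp_coprime i pw) coprime_sym; move: iP; rewrite mem_filter => /andP[].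
Qed.

(** With [t = u + u^-1], one has [u ^+ q = u^-1] and [t ^+ q = t], so the trace of [u / t] is
    [t / t = 1]. Its order is the product of those of [u] and [t], which are coprime because [q] is
    even. *)
Lemma prim_root_of_trace u : (0 < m)%N -> (q.+1).-primitive_root u ->
    (q.-1).-primitive_root (u + u^-1) ->
  (q.-1 * q.+1).-primitive_root (u / (u + u^-1)) /\
  u / (u + u^-1) + (u / (u + u^-1)) ^+ q = 1.
Proof.
move=> m0 pu pt; set t := u + u^-1 in pt *.
have q1 : (1 < q)%N by rewrite -{1}(expn0 2) ltn_exp2l.
have u0 : u != 0 by rewrite (prim_root_eq0 pu).
have t0 : t != 0 by rewrite (prim_root_eq0 pt) -lt0n -ltnS prednK // ltnW.
have tq : t ^+ q.-1 = 1 := prim_expr_order pt.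
have uq : u ^+ q.+1 = 1 := prim_expr_order pu.
split; last first.
  have -> : (u / t) ^+ q = u^-1 / t.
    rewrite exprMn exprVn; congr (_ / _).
      by apply: (mulIf u0); rewrite -exprSr uq mulVf.
    by rewrite -(prednK (ltnW q1)) exprSr tq mul1r.
  by rewrite -mulrDl divff.
have n0 : (0 < q.-1 * q.+1)%N by rewrite muln_gt0 andbT -ltnS prednK // ltnW.
have xn : (u / t) ^+ (q.-1 * q.+1) = 1.
  by rewrite exprMn exprVn [in X in X / _]mulnC !exprM uq tq !expr1n divr1.
have [k pk kn] := prim_order_exists n0 xn.
have cop : coprime q.-1 q.+1.
  have : ~~ odd q by rewrite oddX eqn0Ngt m0.
  case: (q) => //= k'; rewrite negbK => ok.
  by rewrite -addn2 /coprime gcdnDl -/(coprime _ _) coprimen2.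
have xk : (u / t) ^+ k = 1 := prim_expr_order pk.
suff : (q.-1 * q.+1 %| k)%N.
  by move=> nk; have /eqP <- : k == (q.-1 * q.+1)%N by rewrite eqn_dvd kn.
rewrite Gauss_dvd //; apply/andP; split.
  rewrite -(Gauss_dvdl _ cop) (prim_order_dvd pt).
  have := xk => /(congr1 (fun x => x ^+ q.+1)).
  rewrite -exprM mulnC exprMn exprM uq !expr1n mul1r exprVn mulnC => /eqP.
  by rewrite invr_eq1.
rewrite coprime_sym in cop; rewrite -(Gauss_dvdl _ cop) (prim_order_dvd pu).
have := xk => /(congr1 (fun x => x ^+ q.-1)).
have tk : t ^+ (k * q.-1) = 1 by rewrite mulnC exprM tq expr1n.
by rewrite -exprM exprMn exprVn tk expr1n divr1 => ->.
Qed.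

(** Since [u^-1 = u ^+ q], the sum is a trace and lies in the subfield. It is nonzero, as otherwise
    [u ^+ 2 = 1], against the order [q + 1 > 2]. *)
Lemma trace_expf_pred u : (0 < m)%N -> (q.+1).-primitive_root u ->
  (u + u^-1) ^+ q.-1 = 1.
Proof.
move=> m0 pu.
have q1 : (1 < q)%N by rewrite -{1}(expn0 2) ltn_exp2l.
have u0 : u != 0 by rewrite (prim_root_eq0 pu).
have uq : u ^+ q = u^-1.
  by apply: (mulIf u0); rewrite -exprSr (prim_expr_order pu) mulVf.
have t0 : u + u^-1 != 0.
  apply/eqP => /(congr1 ( *%R u)); rewrite mulrDr divff // mulr0 -expr2 => /eqP.
  rewrite addr_eq0 (oppr_pchar2 char2) -(prim_order_dvd pu) => /dvdn_leq.
  by move=> /(_ isT); lia.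
apply: (mulIf t0); rewrite -exprSr prednK ?expn_gt0 // frobenius2D exprVn uq.
by rewrite invrK mul1r addrC.
Qed.

Lemma trace_one_of_separating_poly (Q : {poly L}) : (0 < m)%N -> Q != 0 ->
    (size Q <= totient q.+1)%N ->
    (forall u : L, (q.+1).-primitive_root u -> ~~ root Q u ->
       all (fun p => (u + u^-1) ^+ (q.-1 %/ p) != 1) (primes q.-1)) ->
  exists2 x : L, (q.-1 * q.+1).-primitive_root x & x + x ^+ q = 1.
Proof.
move=> m0 Q0 sQ HQ; have [u pu nr] := exists_order_qS m0 Q0 sQ.
have q0 : (0 < q.-1)%N by rewrite -ltnS prednK ?expn_gt0 // -{1}(expn0 2) ltn_exp2l.
have pt : (q.-1).-primitive_root (u + u^-1).
  by apply: prim_root_of_primes (trace_expf_pred m0 pu) (HQ u pu nr).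
by have [px tx] := prim_root_of_trace m0 pu pt; exists (u / (u + u^-1)).
Qed.

(** Otherwise the [j]-th Frobenius power fixes the trace, and the order [q + 1] of [u] divides
    [2 ^ j - 1] or [2 ^ j + 1], both positive and below [q + 1]. *)
Lemma trace_neq_fixed j (u : L) : (2 ^ j < q)%N -> (q.+1).-primitive_root u ->
  (0 < j)%N -> (u + u^-1) ^+ (2 ^ j).-1 != 1.
Proof.
move=> jq pu j0; apply/eqP => t1.
have u0 : u != 0 by rewrite (prim_root_eq0 pu).
have jg : (1 < 2 ^ j)%N by rewrite -{1}(expn0 2) ltn_exp2l.
have [||] := @exprV_trace_fixed j u u0.
- by rewrite -(prednK (ltnW jg)) exprSr t1 mul1r.
- move/eqP; rewrite -(prim_order_dvd pu) => /dvdn_leq H.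
  by have := H _; lia.
move/eqP; rewrite -(prim_order_dvd pu) => /dvdn_leq => /(_ isT).
by rewrite ltnS leqNgt jq.
Qed.

(** For these [m], [q - 1] is 1 or prime, so at most the value 1 has to be excluded for the trace,
    and [Q = 1] suffices. *)
Lemma trace_one_small : m \in [:: 1; 2; 3; 5]%N ->
  exists2 x : L, (q.-1 * q.+1).-primitive_root x & x + x ^+ q = 1.
Proof.
move=> mS; have m0 : (0 < m)%N by move: mS; case: (m).
apply: (@trace_one_of_separating_poly 1); rewrite ?oner_eq0 // ?size_poly1.
  by rewrite totient_gt0.
move=> u pu _; have [m1|m1] := eqVneq m 1%N; first by rewrite m1.
have -> : primes q.-1 = [:: q.-1].
  by move: mS m1; rewrite !inE => /or4P[]/eqP->.
rewrite /= divnn -ltnS prednK ?expn_gt0 // -{1}(expn0 2) ltn_exp2l // m0 andbT.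
by apply: (@trace_neq_fixed 1) => //; rewrite ltn_exp2l // ltn_neqAle eq_sym m1.
Qed.

Lemma horner_X2D1 u : u != 0 -> ('X^2 + 1).[u] = u * (u + u^-1).
Proof.
by move=> u0; rewrite hornerD hornerXn hornerC mulrDr divff // expr2.
Qed.

Let size_X2D1 k : (size (('X^2 + 1 : {poly L}) ^+ k) <= (2 * k).+1)%N.
Proof. by apply: leq_trans (size_exp_leq _ _) _; rewrite size_XnaddC. Qed.

(* The roots of [R] are the [u] with [(u + u^-1) ^+ a = 1], those of [S] the [u]
   such that [(u + u^-1) ^+ e] is a primitive cube root of unity. *)
Lemma trace_one_cyclotomic a j : (0 < a)%N -> (0 < j)%N -> (2 ^ j < q)%N ->
    (2 * a + 4 * (2 ^ j).-1 < totient q.+1)%N ->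
    all (fun p => (q.-1 %/ p)%N \in [:: a; 3 * (2 ^ j).-1]%N) (primes q.-1) ->
  exists2 x : L, (q.-1 * q.+1).-primitive_root x & x + x ^+ q = 1.
Proof.
set e := (2 ^ j).-1 => a0 j0 jq tot pP.
have m0 : (0 < m)%N by case: (m) jq => //; rewrite expn0 ltnS leqNgt expn_gt0.
have e0 : (0 < e)%N by rewrite -ltnS prednK ?expn_gt0 // -{1}(expn0 2) ltn_exp2l.
pose P : {poly L} := 'X^2 + 1.
have sizeP k : (size (P ^+ k) <= (2 * k).+1)%N := size_X2D1 k.
have P0 : P.[0] = 1 by rewrite hornerD hornerXn hornerC expr0n add0r.
have Pu u : u != 0 -> P.[u] = u * (u + u^-1) by exact: horner_X2D1.
clearbody P.
pose R : {poly L} := P ^+ a - 'X^a.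
pose S : {poly L} := P ^+ (2 * e) + 'X^e * P ^+ e + 'X^(2 * e).
have RS0 : (R * S).[0] = 1.
  rewrite hornerM /R /S !(hornerD, hornerN, hornerM, hornerXn, horner_exp) P0.
  by rewrite !expr1n !expr0n muln_eq0 !gtn_eqF //= !mul0r subr0 !addr0 mul1r.
apply: (@trace_one_of_separating_poly (R * S)) => //.
- by apply/eqP => E0; move/eqP: RS0; rewrite E0 horner0 eq_sym oner_eq0.
- apply: leq_trans (size_polyMleq _ _) _.
  have sR : (size R <= (2 * a).+1)%N.
    apply: leq_trans (size_polyD _ _) _; rewrite geq_max sizeP size_polyN size_polyXn.
    by rewrite ltnS leq_pmull.
  have sS : (size S <= (4 * e).+1)%N.
    apply: leq_trans (size_polyD _ _) _; rewrite geq_max size_polyXn ltnS leq_pmul2r // andbT.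
    apply: leq_trans (size_polyD _ _) _; rewrite geq_max.
    rewrite (leq_trans (sizeP _)) ?mulnA //=.
    apply: leq_trans (size_polyMleq _ _) _; rewrite size_polyXn /=.
    by apply: leq_trans (leq_add (leqnn _) (sizeP _)) _; lia.
  by move: (size R) (size S) sR sS tot => x y; lia.
move=> u pu; have u0 : u != 0 by rewrite (prim_root_eq0 pu).
set t := u + u^-1.
rewrite rootM negb_or /root /R /S !(hornerD, hornerN, hornerM, hornerXn, horner_exp) Pu //.
have -> : (u * t) ^+ a - u ^+ a = u ^+ a * (t ^+ a - 1).
  by rewrite exprMn mulrBr mulr1.
have -> : (u * t) ^+ (2 * e) + u ^+ e * (u * t) ^+ e + u ^+ (2 * e) =
    u ^+ (2 * e) * (t ^+ (2 * e) + t ^+ e + 1).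
  by rewrite !exprMn !(mulnC 2%N) !exprM; ring.
rewrite !mulf_eq0 !negb_or !expf_neq0 //= subr_eq0 => /andP[ta te].
apply/allP => p /(allP pP); rewrite !inE => /orP[]/eqP-> //.
rewrite -subr_eq0 mulnC exprM.
have -> : (t ^+ e) ^+ 3 - 1 = (t ^+ e - 1) * (t ^+ (2 * e) + t ^+ e + 1).
  by rewrite mulnC exprM; ring.
by rewrite mulf_neq0 // subr_eq0 (trace_neq_fixed jq pu).
Qed.

Lemma trace_one_le6 : (0 < m <= 6)%N ->
  exists2 x : L, (q.-1 * q.+1).-primitive_root x & x + x ^+ q = 1.
Proof.
move=> m06; have [/trace_one_small//|mS] := boolP (m \in [:: 1; 2; 3; 5]%N).
have : (m == 4)%N || (m == 6)%N by move: m06 mS; rewrite !inE; lia.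
case/orP => /eqP m46.
  (* The quotients of [q - 1 = 15] are 5 and [3 * 1], and [2 * 5 + 4 * 1 = 14 < 16 = totient 17]. *)
  by apply: (@trace_one_cyclotomic 5 1); rewrite // m46.
(* The quotients of [q - 1 = 63] are 9 and [3 * 7], and [2 * 9 + 4 * 7 = 46 < 48 = totient 65]. *)
by apply: (@trace_one_cyclotomic 9 3); rewrite // m46.
Qed.

End SmallFields.

(** * From a generator of trace one to the matrix *)

Lemma companion_exists (R : comNzRingType) m (f : {poly R}) :
  f \is monic -> size f = m.+1 -> exists A : 'M[R]_m, char_poly A = f.
Proof.
move=> fm sf; have E : (size f).-1 = m by rewrite sf.
by case: m / E {sf}; exists (companionmx f); exact: companionmxK.
Qed.

Section FieldExtension.

Variables (F L : finFieldType) (iota : {rmorphism F -> L}).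
Implicit Types (f g h : {poly F}) (b x : L) (d m : nat).

Local Notation "f ^io" := (map_poly iota f) (at level 2).

Lemma horner_expf_card m f b :
    (forall x y : L, (x + y) ^+ (#|F| ^ m) = x ^+ (#|F| ^ m) + y ^+ (#|F| ^ m)) ->
    b ^+ (#|F| ^ m) = b ->
  f^io.[b] ^+ (#|F| ^ m) = f^io.[b].
Proof.
move=> frobD bK.
have cK (c : F) : c ^+ (#|F| ^ m) = c.
  by elim: m {frobD bK} => [|m IH]; rewrite ?expr1 // expnS exprM expf_card.
elim/poly_ind: f => [|f c IH].
  rewrite rmorph0 horner0 expr0n gtn_eqF // expn_gt0.
  by rewrite ltnW ?finNzRing_gt1.
rewrite rmorphD rmorphM /= map_polyX map_polyC /= hornerMXaddC.
by rewrite frobD exprMn IH bK -rmorphXn cK.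
Qed.

(** Pigeonhole: the [#|F| ^ m.+1] polynomials of degree at most [m] take their values at [b] among
    at most [#|F| ^ m] fixed elements. *)
Lemma annihilating_poly m b :
    (forall x y : L, (x + y) ^+ (#|F| ^ m) = x ^+ (#|F| ^ m) + y ^+ (#|F| ^ m)) ->
    b ^+ (#|F| ^ m) = b -> (0 < m)%N ->
  exists f, [/\ f \is monic, size f = m.+1 & root f^io b].
Proof.
move=> frobD bK m0.
have F1 := finNzRing_gt1 F.
pose ev (v : 'rV[F]_m.+1) := (rVpoly v)^io.[b].
have : ~~ injectiveb ev.
  apply/injectiveP => inj.
  have sub : {subset image ev predT <= [pred y | y ^+ (#|F| ^ m) == y]}.
    by move=> _ /imageP[v _ ->]; rewrite inE horner_expf_card.
  have q1 : (1 < #|F| ^ m)%N by rewrite -{1}(expn0 #|F|) ltn_exp2l.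
  have := leq_trans (subset_leq_card (introT subsetP sub)) (card_expf_fixed_le L q1).
  by rewrite card_image // card_mx mul1n leq_exp2l // ltnn.
case/injectivePn => v [w vw evw].
pose p := rVpoly (v - w).
have p0 : p != 0.
  by apply: contraNneq vw => p0; rewrite -subr_eq0 -[v - w]rVpolyK -/p p0 raddf0.
have rp : root p^io b.
  by rewrite /p raddfB rmorphB /root hornerD hornerN /= subr_eq0; apply/eqP.
have sp : (size p <= m.+1)%N by exact: size_poly.
have sp0 : (0 < size p)%N by rewrite size_poly_gt0.
(* The degree of [p] may be too small; a power of ['X] raises it to exactly [m] and keeps the
   root. *)
exists ((lead_coef p)^-1 *: p * 'X^(m.+1 - size p)); split.
- rewrite monicMr ?monicXn // monicE lead_coefZ mulVf ?lead_coef_eq0 //.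
- rewrite size_mulXn ?scaler_eq0 ?invr_eq0 ?lead_coef_eq0 ?(negPf p0) //.
  by rewrite size_scale ?invr_eq0 ?lead_coef_eq0 // subnK.
- by rewrite rmorphM rootM -mul_polyC rmorphM rootM rp orbT.
Qed.

(** Every element of [L] is 0 or a power of [a], hence the value at [a] of a remainder modulo [h];
    it remains to count remainders. *)
Lemma size_root_prim d h (a : L) : #|L| = (#|F| ^ d)%N ->
    (#|L|.-1).-primitive_root a -> h != 0 -> root h^io a -> (d < size h)%N.
Proof.
move=> cL pa h0 ra; have F1 := finNzRing_gt1 F.
have sh : (0 < size h)%N by rewrite size_poly_gt0.
rewrite -(prednK sh) ltnS -(leq_exp2l _ _ F1) -cL.
pose ev (v : 'rV[F]_(size h).-1) := (rVpoly v)^io.[a].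
have : {subset predT <= image ev predT}.
  move=> x _; pose r p := poly_rV (p %% h) : 'rV[F]_(size h).-1.
  have evr p : ev (r p) = p^io.[a].
    rewrite /ev poly_rV_K; last by rewrite -ltnS prednK // ltn_modp.
    rewrite [in RHS](divp_eq p h) rmorphD rmorphM /= hornerD hornerM (eqP ra).
    by rewrite mulr0 add0r.
  have [->|x0] := eqVneq x 0.
    by rewrite -[0](horner0 a) -(rmorph0 (map_poly iota)) -evr image_f.
  have xn : x ^+ #|L|.-1 = 1.
    apply: (mulIf x0); rewrite -exprSr prednK ?expf_card ?mul1r //.
    by rewrite ltnW ?finNzRing_gt1.
  have [i ->] := prim_rootP pa xn.
  by rewrite -(hornerXn _ i) -(map_polyXn iota) -evr image_f.
move/subsetP/subset_leq_card/leq_trans; apply.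
apply: leq_trans (leq_image_card _ _) _.
by rewrite card_mx mul1n.
Qed.

(** A factor of [g] that vanishes at [a] already has full degree, so [g] is irreducible; the order
    of ['X] modulo [g] is then that of [a]. *)
Lemma primitive_poly_of_root d g (a : L) : (0 < d)%N -> #|L| = (#|F| ^ d)%N ->
    (#|L|.-1).-primitive_root a -> g \is monic -> size g = d.+1 ->
    root g^io a -> primitive_poly g.
Proof.
move=> d0 cL pa gm sg ra; have big := size_root_prim cL pa.
have g0 : g != 0 by rewrite monic_neq0.
have irr : irreducible_poly g.
  split=> [|h sh /dvdpP[r Eg]]; first by rewrite sg ltnS.
  have [r0 h0] : r != 0 /\ h != 0 by apply/andP; rewrite -negb_or -mulf_eq0 -Eg.
  move: ra; rewrite Eg rmorphM rootM => /orP[/(big _ r0)|/(big _ h0)] sd.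
    have := sg; rewrite Eg size_mul // => E; case/eqP: sh.
    have := h0; rewrite -size_poly_gt0 => hp.
    by move: (size r) (size h) sd E hp => j k; lia.
  have hg : h %| g by rewrite Eg dvdp_mull.
  rewrite -Eg -(dvdp_size_eqp hg) eqn_leq dvdp_leq // sg; exact: sd.
have dvdE h : (g %| h) = root h^io a.
  apply/idP/idP => [/dvdpP[r ->]|rh]; first by rewrite rmorphM rootM ra orbT.
  apply: contraT; rewrite -irreducible_poly_coprime // => cgh.
  have : coprimep g^io h^io by rewrite coprimep_map.
  by move/coprimep_root => /(_ _ ra); rewrite (eqP rh) eqxx.
have dvdX n : (g %| 'X^n - 1) = (#|L|.-1 %| n)%N.
  rewrite dvdE rmorphB /= map_polyXn rmorph1 /root hornerD hornerN hornerXn hornerC.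
  by rewrite subr_eq0 (prim_order_dvd pa).
apply/primitive_polyP; rewrite card_monic_qpoly ?sg // -cL.
split=> //; first by rewrite dvdX.
by move=> n /andP[n0 nL]; rewrite dvdX gtnNdvd.
Qed.

Lemma tsr2_primitive m (x : L) : (0 < m)%N ->
    #|L| = (#|F| ^ (m + m))%N ->
    (forall x y : L, (x + y) ^+ (#|F| ^ m) = x ^+ (#|F| ^ m) + y ^+ (#|F| ^ m)) ->
    (#|L|.-1).-primitive_root x -> x + x ^+ (#|F| ^ m) = 1 ->
  exists A : 'M[F]_m, primitive_poly (char_poly (tsr2_mx (-1) 1 A)).
Proof.
move=> m0 cL frobD px tx; set q := (#|F| ^ m)%N in frobD tx.
have n0 : (0 < #|L|.-1)%N := prim_order_gt0 px.
have x0 : x != 0 by rewrite (prim_root_eq0 px) -lt0n.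
have xq : (x ^+ q) ^+ q = x by rewrite -exprM -expnD -cL expf_card.
pose b := (x * x ^+ q)^-1.
have bq : b ^+ q = b by rewrite exprVn exprMn xq mulrC.
have [f [fm sf rb]] := annihilating_poly frobD bq m0.
have [A chA] := companion_exists fm sf.
exists A.
have pa : (#|L|.-1).-primitive_root x^-1.
  have -> : x^-1 = x ^+ (#|L|.-1).-1.
    by apply: (mulIf x0); rewrite mulVf // -exprSr prednK // prim_expr_order.
  by rewrite (prim_root_exp_coprime _ px) coprimePn.
apply: primitive_poly_of_root cL pa _ _ _; rewrite ?char_poly_monic ?size_char_poly //.
  by rewrite addn_gt0 m0.
have : eigenvalue (map_mx iota A) b.
  by rewrite eigenvalue_root_char -map_char_poly chA.
case/eigenvalueP => v vA v0.
rewrite map_char_poly -eigenvalue_root_char; apply/eigenvalueP.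
exists (row_mx v (x^-1 *: v)).
  rewrite /tsr2_mx map_block_mx map_mx0 map_scalar_mx rmorph1 !map_mxZ.
  rewrite mul_row_block mulmx0 add0r mulmx1 -!scalemxAl -!scalemxAr vA.
  rewrite scale_row_mx !scalerA -scalerDl rmorphN1 rmorph1 mulr1.
  (* The second block requires [a ^+ 2 = b * (a - 1)] for [a = x^-1], which follows from
     [x ^+ q = 1 - x]. *)
  congr row_mx; congr (_ *: v).
  have xqE : x ^+ q = 1 - x by rewrite -tx addrC addKr.
  have xq0 : 1 - x != 0 by rewrite -xqE expf_neq0.
  by rewrite /b xqE; field; rewrite x0 xq0.
apply: contraNneq v0 => /(congr1 lsubmx); rewrite row_mxKl => ->.
by rewrite raddf0.
Qed.

End FieldExtension.

(** * Generators of trace one for every m, and the resulting TSR matrix over F_2 *)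

Lemma exists_prim_root_trace_one m (L : finFieldType) : (0 < m)%N ->
    2%N \in [pchar L] -> #|L| = (2 ^ m * 2 ^ m)%N ->
  exists2 x : L, (#|L|.-1).-primitive_root x & x + x ^+ (2 ^ m) = 1.
Proof.
move=> m0 ch cL; have q1 : (1 < 2 ^ m)%N by rewrite -{1}(expn0 2) ltn_exp2l.
have nE : #|L|.-1 = ((2 ^ m).-1 * (2 ^ m).+1)%N by rewrite cL; nia.
have [m6|m6] := leqP m 6.
  by rewrite nE; apply: trace_one_le6; rewrite // m0.
have cLn : #|L| = #|L|.-1.+1 by rewrite prednK // cL; nia.
(* Here [s] is the square root of [2 ^ m] rounded up to a power of 2; as [uphalf m + m./2 = m], the
   sieve allows [m./2] primes. *)
apply: (@sieve_prim_root L _ (2 ^ m) cLn cL _ (2 ^ uphalf m)).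
- exact: frobenius2D.
- by rewrite expn_gt0.
- by rewrite -expnM leq_exp2l //; lia.
- have -> : #|L|.-1 = (4 ^ m - 1)%N by rewrite cL -expnMn subn1.
  rewrite -expnD leq_exp2l //; have := size_primes_le_half m6; lia.
Qed.

Theorem theorem6p3 (m : nat) (hm : (1 <= m)%N) :
  exists (c0 c1 : 'F_2) (A : 'M['F_2]_m),
    size (char_poly (tsr2_mx c0 c1 A)) = (2 * m).+1 /\
    primitive_poly (char_poly (tsr2_mx c0 c1 A)).
Proof.
have [|L0 ch cL0] := @pPrimePowerField 2 (m + m) isT; first by rewrite addn_gt0 hm.
pose L : finFieldType := pPrimeCharType ch.
have cF : #|'F_2| = 2%N by rewrite card_Fp.
have cL : #|L| = (2 ^ m * 2 ^ m)%N by rewrite -expnD; exact: cL0.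
have [x px tx] := @exists_prim_root_trace_one m L hm ch cL.
have [] := @tsr2_primitive 'F_2 L (in_alg L) m x hm; rewrite ?cF //; first exact: frobenius2D.
move=> A pA; exists (-1), 1, A; split=> //.
by rewrite size_char_poly mul2n addnn.
Qed.
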